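(* For integers $n\ge 0$ and $m\ge 0$ put $$S_m(n)=\sum_{k=1,\; z_{n,k}\neq 0}^{\frac{1}{2}n(n+1)}\frac{1}{z_{n,k}^m},$$ where $z_{n,k}$, $1\le k\le\frac12 n(n+1)$, are the (distinct) complex roots of the Yablonskii--Vorob'ev polynomial $Q_n$. Then: (a) for every integer $m\ge 3$ divisible by $3$ and each residue $r\in\{0,1,2\}$ there exists a polynomial $P_{m,r}$ in one variable with rational coefficients such that $S_m(n)=P_{m,r}(n)$ for all $n\ge 0$ with $n\equiv r\pmod 3$; (b) if $m\not\equiv 0\pmod 3$, then $S_m(n)=0$ for all $n\ge 0$; (c) consequently, $S_m(n)\in\mathbb{Q}$ for all integers $n,m\ge 0$.
   Context: The Yablonskii--Vorob'ev polynomials $Q_n$ ($n\ge 0$) are defined by $Q_0=1$, $Q_1=z$ and the differential-difference equation $Q_{n+1}Q_{n-1}=zQ_n^2-4\left(Q_nQ_n''-(Q_n')^2\right)$ for $n\ge1$, where $'$ denotes $d/dz$. It is known that each $Q_n$ is a monic polynomial in $z$ of degree $\frac12 n(n+1)$ with integer coefficients, and (Fukutani, Okamoto, Umemura) that all roots of $Q_n$ are simple, so $Q_n$ has exactly $\frac12 n(n+1)$ distinct complex roots $z_{n,k}$. The sums run over the nonzero roots only; empty sums are $0$. *)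

(* Defs.v *)
From HB Require Import structures.
From mathcomp Require Import all_boot all_order all_algebra.
From mathcomp Require Import boolp classical_sets functions cardinality fsbigop.
From mathcomp Require Import reals complex.

Set Implicit Arguments.
Unset Strict Implicit.
Unset Printing Implicit Defensive.

Import Order.TTheory GRing.Theory Num.Theory.
Local Open Scope ring_scope.
Local Open Scope classical_set_scope.

(* The complex field is R[i], where R is a realType.  That polynomials
   satisfying the recurrence exist is a classical theorem.  They are unique:
   comparing leading coefficients shows that no Q n vanishes, so Q n.+1 is
   determined by Q n and Q n.-1. *)
Definition yablonskii_vorobev (R : realType) (Q : nat -> {poly R[i]}) : Prop :=
  [/\ Q 0%N = 1,
      Q 1%N = 'X &
      forall n : nat, (1 <= n)%N ->
        Q n.+1 * Q n.-1
        = 'X * Q n ^+ 2 - 4 * (Q n * (Q n)^`(2) - (Q n)^`() ^+ 2)].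

(* Each root is counted once.  The root set is finite as soon as p != 0; a
   finitely supported sum over an infinite support would be 0 by convention. *)
Definition root_power_sum (R : realType) (p : {poly R[i]}) (m : nat) : R[i] :=
  \sum_(z \in [set z : R[i] | root p z /\ z != 0]) z ^- m.

(* Main.v *)
Require Import Defs.
From HB Require Import structures.
From mathcomp Require Import all_boot all_order all_algebra.
From mathcomp Require Import boolp classical_sets functions cardinality fsbigop.
From mathcomp Require Import reals complex.
From mathcomp Require Import ring zify.

Set Implicit Arguments.
Unset Strict Implicit.
Unset Printing Implicit Defensive.

Import Order.TTheory GRing.Theory Num.Theory.
Local Open Scope ring_scope.

(** Put u = (log (Q_n / Q_(n-1)))' and s = (log (Q_n Q_(n-1)))'.  The
    recurrence propagates two Hirota bilinear equations for the pair
    (Q_n, Q_(n-1)), which say s = - u^2 and u'' = 2 u^3 + z u - n (Painleve II).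
    The first of them forces simple roots.  Rotation by a primitive cube root
    of unity permutes the roots of Q_n, which gives (b) and shows that Q_n
    vanishes at 0 only for n = 1 mod 3.  For n = 0 or 1 mod 3, Painleve II
    determines the Laurent coefficients of u at 0 recursively as polynomials
    in n: the resonant exponents are not multiples of 3 (after multiplying u
    by z), so symmetry makes the corresponding coefficients vanish.  The
    logarithmic derivatives of Q_n and Q_(n-1), whose Taylor coefficients are
    the - S_m, are then recovered from 2 (log Q_n)'' = u' - u^2 and
    2 (log Q_(n-1))'' = - u' - u^2; the second one, at n + 1, settles
    n = 2 mod 3. *)

(** * Rational identities between derivatives *)

Section JetIdentities.

(** Reduces an equality to a [ring] identity: [e] is a combination of the hypotheses that is known
    to vanish. *)
Lemma eq_via0 (V : zmodType) (x y e : V) : e = 0 -> x - y = e -> x = y.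
Proof. by move=> -> /subr0_eq. Qed.

Lemma add_eq0 (V : zmodType) (x y : V) : x = 0 -> y = 0 -> x + y = 0.
Proof. by move=> -> ->; rewrite addr0. Qed.

(* Here f0, f1, ... are a function f and its derivatives, and z is the variable.
   The hypotheses are the bilinear equations for (g, f), the recurrence, and as
   many of their derivatives as are needed to express all the jets rationally
   in z, n, f0, f1, f2, g0, g1 over a field K containing A. *)
Lemma jet_hirota2 (A : idomainType) (K : fieldType)
    (phi : {rmorphism A -> K})
    (z n f0 f1 f2 f3 f4 g0 g1 g2 g3 g4 h0 h1 h2 : A) :
  injective phi -> (2 : A) != 0 -> f0 != 0 -> g0 != 0 ->
  g2 * f0 - 2 * g1 * f1 + g0 * f2 = 0 ->
  g3 * f0 - g2 * f1 - g1 * f2 + g0 * f3 = 0 ->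
  g4 * f0 - 2 * g2 * f2 + g0 * f4 = 0 ->
  g3 * f0 - 3 * g2 * f1 + 3 * g1 * f2 - g0 * f3
    - z * (g1 * f0 - g0 * f1) + n * (g0 * f0) = 0 ->
  g4 * f0 - 2 * g3 * f1 + 2 * g1 * f3 - g0 * f4 - (g1 * f0 - g0 * f1)
    - z * (g2 * f0 - g0 * f2) + n * (g1 * f0 + g0 * f1) = 0 ->
  h0 * f0 = z * g0 ^+ 2 - 4 * (g0 * g2 - g1 ^+ 2) ->
  h1 * f0 + h0 * f1 = g0 ^+ 2 + 2 * z * g0 * g1 - 4 * (g0 * g3 - g1 * g2) ->
  h2 * f0 + 2 * h1 * f1 + h0 * f2 =
    4 * g0 * g1 + 2 * z * (g1 ^+ 2 + g0 * g2) - 4 * (g0 * g4 - g2 ^+ 2) ->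
  h2 * g0 - 2 * h1 * g1 + h0 * g2 = 0.
Proof.
have tr (p q : A) : p = q -> phi p = phi q by move->.
move=> inj.
have phi_neq0 p : p != 0 -> phi p != 0.
  by rewrite -(inj_eq inj) rmorph0.
pose E := (rmorphM phi, rmorphD phi, rmorphN phi, rmorphXn phi, rmorph_nat phi,
           rmorph0 phi).
move=> /phi_neq0 two /phi_neq0 f0n /phi_neq0 g0n /tr e1 /tr e1' /tr e1''.
move=> /tr e2 /tr e2' /tr k /tr k' /tr k''.
apply: inj.
rewrite !E in two e1 e1' e1'' e2 e2' k k' k'' *.
move: (phi z) (phi n) (phi f0) (phi f1) (phi f2) (phi f3)
  (phi f4) (phi g0) (phi g1) (phi g2) (phi g3) (phi g4)
  (phi h0) (phi h1) (phi h2) two f0n g0n e1 e1' e1'' e2 e2' k k' k''.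
move=> {}z {}n {}f0 {}f1 {}f2 {}f3 {}f4 {}g0 {}g1 {}g2 {}g3 {}g4 {}h0 {}h1 {}h2.
move=> two f0n g0n e1 e1' e1'' e2 e2' k k' k''.
have twof0 := mulf_neq0 two f0n.
have E2 : g2 = (2 * g1 * f1 - g0 * f2) / f0.
  by apply: (mulIf f0n); rewrite mulfVK //; apply: (eq_via0 e1); ring.
(* The sum of the two third-order equations is free of [f3]; this is where the factor 2 in the
   denominator comes from. *)
have E3 : g3 = (4 * g2 * f1 - 2 * g1 * f2 + z * (g1 * f0 - g0 * f1)
    - n * (g0 * f0)) / (2 * f0).
  apply: (mulIf twof0); rewrite mulfVK //.
  by apply: (eq_via0 (add_eq0 e1' e2)); ring.
have F3 : f3 = (g2 * f1 + g1 * f2 - g3 * f0) / g0.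
  by apply: (mulIf g0n); rewrite mulfVK //; apply: (eq_via0 e1'); ring.
have E4 : g4 = (2 * g2 * f2 + 2 * g3 * f1 - 2 * g1 * f3 + (g1 * f0 - g0 * f1)
    + z * (g2 * f0 - g0 * f2) - n * (g1 * f0 + g0 * f1)) / (2 * f0).
  apply: (mulIf twof0); rewrite mulfVK //.
  by apply: (eq_via0 (add_eq0 e1'' e2')); ring.
have H0 : h0 = (z * g0 ^+ 2 - 4 * (g0 * g2 - g1 ^+ 2)) / f0.
  by rewrite -k mulfK.
have H1 : h1 = (g0 ^+ 2 + 2 * z * g0 * g1 - 4 * (g0 * g3 - g1 * g2)
    - h0 * f1) / f0.
  by rewrite -k' addrK mulfK.
have H2 : h2 = (4 * g0 * g1 + 2 * z * (g1 ^+ 2 + g0 * g2)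
    - 4 * (g0 * g4 - g2 ^+ 2) - 2 * h1 * f1 - h0 * f2) / f0.
  by rewrite -k''; field.
rewrite H2 H1 H0 E4 F3 E3 E2; field.
by rewrite two f0n g0n.
Qed.

(** The conclusion of [jet_hirota2] and its derivative serve as hypotheses here: they give [h2] and
    [h3] without any fourth-order jet. *)
Lemma jet_hirota3 (A : idomainType) (K : fieldType)
    (phi : {rmorphism A -> K})
    (z n f0 f1 f2 f3 g0 g1 g2 g3 h0 h1 h2 h3 : A) :
  injective phi -> (2 : A) != 0 -> f0 != 0 -> g0 != 0 ->
  g2 * f0 - 2 * g1 * f1 + g0 * f2 = 0 ->
  g3 * f0 - g2 * f1 - g1 * f2 + g0 * f3 = 0 ->
  g3 * f0 - 3 * g2 * f1 + 3 * g1 * f2 - g0 * f3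
    - z * (g1 * f0 - g0 * f1) + n * (g0 * f0) = 0 ->
  h0 * f0 = z * g0 ^+ 2 - 4 * (g0 * g2 - g1 ^+ 2) ->
  h1 * f0 + h0 * f1 = g0 ^+ 2 + 2 * z * g0 * g1 - 4 * (g0 * g3 - g1 * g2) ->
  h2 * g0 - 2 * h1 * g1 + h0 * g2 = 0 ->
  h3 * g0 - h2 * g1 - h1 * g2 + h0 * g3 = 0 ->
  h3 * g0 - 3 * h2 * g1 + 3 * h1 * g2 - h0 * g3
    - z * (h1 * g0 - h0 * g1) + (n + 1) * (h0 * g0) = 0.
Proof.
have tr (p q : A) : p = q -> phi p = phi q by move->.
move=> inj.
have phi_neq0 p : p != 0 -> phi p != 0.
  by rewrite -(inj_eq inj) rmorph0.
pose E := (rmorphM phi, rmorphD phi, rmorphN phi, rmorphXn phi, rmorph_nat phi,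
           rmorph0 phi).
move=> /phi_neq0 two /phi_neq0 f0n /phi_neq0 g0n /tr e1 /tr e1' /tr e2.
move=> /tr k /tr k' /tr d /tr d'.
apply: inj.
rewrite !E in two e1 e1' e2 k k' d d' *.
move: (phi z) (phi n) (phi f0) (phi f1) (phi f2) (phi f3)
  (phi g0) (phi g1) (phi g2) (phi g3) (phi h0) (phi h1)
  (phi h2) (phi h3) two f0n g0n e1 e1' e2 k k' d d'.
move=> {}z {}n {}f0 {}f1 {}f2 {}f3 {}g0 {}g1 {}g2 {}g3 {}h0 {}h1 {}h2 {}h3.
move=> two f0n g0n e1 e1' e2 k k' d d'.
have twof0 := mulf_neq0 two f0n.
have E2 : g2 = (2 * g1 * f1 - g0 * f2) / f0.
  by apply: (mulIf f0n); rewrite mulfVK //; apply: (eq_via0 e1); ring.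
have E3 : g3 = (4 * g2 * f1 - 2 * g1 * f2 + z * (g1 * f0 - g0 * f1)
    - n * (g0 * f0)) / (2 * f0).
  apply: (mulIf twof0); rewrite mulfVK //.
  by apply: (eq_via0 (add_eq0 e1' e2)); ring.
have H0 : h0 = (z * g0 ^+ 2 - 4 * (g0 * g2 - g1 ^+ 2)) / f0.
  by rewrite -k mulfK.
have H1 : h1 = (g0 ^+ 2 + 2 * z * g0 * g1 - 4 * (g0 * g3 - g1 * g2)
    - h0 * f1) / f0.
  by rewrite -k' addrK mulfK.
have H2 : h2 = (2 * h1 * g1 - h0 * g2) / g0.
  by apply: (mulIf g0n); rewrite mulfVK //; apply: (eq_via0 d); ring.
have H3 : h3 = (h2 * g1 + h1 * g2 - h0 * g3) / g0.
  by apply: (mulIf g0n); rewrite mulfVK //; apply: (eq_via0 d'); ring.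
rewrite H3 H2 H1 H0 E3 E2; field.
by rewrite two f0n g0n.
Qed.

End JetIdentities.

(** * Bilinear equations and their propagation *)

Section Hirota.
Variable K : numFieldType.
Implicit Types (p q f g h : {poly K}) (n : nat).

(** The Hirota derivatives D^2 p.q and D^3 p.q. Divided by p q, the first one is (log (p q))'' +
    ((log (p / q))')^2. *)
Definition hirota2 p q := p^`()^`() * q - (p^`() * q^`()) *+ 2 + p * q^`()^`().

Definition hirota3 p q :=
  p^`()^`()^`() * q - (p^`()^`() * q^`()) *+ 3
  + (p^`() * q^`()^`()) *+ 3 - p * q^`()^`()^`().

(** With u = (log (g / f))' and s = (log (g f))', division by g f gives s' + u^2 = 0 and u'' + 3 u
    s' + u^3 - z u + n = 0. *)
Definition backlund_pair n g f :=
  hirota2 g f = 0 /\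
  hirota3 g f - 'X * (g^`() * f - g * f^`()) + (g * f) *+ n = 0.

Definition toda f g h :=
  h * f = 'X * g ^+ 2 - (g * g^`()^`() - g^`() ^+ 2) *+ 4.

(** The Backlund transformation n -> n + 1 of Painleve II in bilinear form. The jet identities are
    applied to iterated derivatives, with polynomials embedded in their fraction field. *)
Lemma backlund_pair_step n f g h : f != 0 -> g != 0 ->
  toda f g h -> backlund_pair n g f -> backlund_pair n.+1 h g.
Proof.
move=> f0 g0 t0 [e10 e20].
have dE := (derivM, derivB, derivD, derivX, derivMn, deriv_exp).
have d1 : (1 : {poly K})^`() = 0 := derivC 1.
have d0 p : p = 0 -> p^`() = 0 by move->; rewrite deriv0.
have two : (2 : {poly K}) != 0 by rewrite -polyC_natr polyC_eq0 pnatr_eq0.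
pose phi : {rmorphism {poly K} -> {fraction {poly K}}} := @tofrac {poly K}.
have phi_inj : injective phi by move=> p q /eqP; rewrite tofrac_eq => /eqP.
clearbody phi.
have e11 : g^`()^`()^`() * f - g^`()^`() * f^`() - g^`() * f^`()^`()
    + g * f^`()^`()^`() = 0.
  by apply: etrans (d0 _ e10); rewrite !dE; ring.
have d20 : hirota2 h g = 0.
  apply: (eq_via0 (jet_hirota2 (z := 'X) (n := n%:R)
    (f1 := f^`()) (f2 := f^`()^`()) (f3 := f^`()^`()^`())
    (f4 := f^`()^`()^`()^`()) (g1 := g^`()) (g2 := g^`()^`())
    (g3 := g^`()^`()^`()) (g4 := g^`()^`()^`()^`()) (h0 := h) (h1 := h^`())
    (h2 := h^`()^`()) phi_inj two f0 g0 _ _ _ _ _ _ _ _)).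
  - by apply: etrans e10; rewrite /hirota2; ring.
  - by apply: etrans e11; ring.
  - by apply: etrans (d0 _ e11); rewrite !dE; ring.
  - by apply: etrans e20; rewrite /hirota3; ring.
  - by apply: etrans (d0 _ e20); rewrite !dE; ring.
  - by rewrite t0; ring.
  - by rewrite -derivM t0 !dE; ring.
  - apply: (@etrans _ _ (h * f)^`()^`()); first by rewrite !dE; ring.
    by rewrite t0 !dE d1; ring.
  - by rewrite /hirota2; ring.
split=> //.
apply: (eq_via0 (jet_hirota3 (z := 'X) (n := n%:R)
  (f1 := f^`()) (f2 := f^`()^`()) (f3 := f^`()^`()^`()) (g1 := g^`())
  (g2 := g^`()^`()) (g3 := g^`()^`()^`()) (h0 := h) (h1 := h^`())
  (h2 := h^`()^`()) (h3 := h^`()^`()^`()) phi_inj two f0 g0 _ _ _ _ _ _ _)).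
- by apply: etrans e10; rewrite /hirota2; ring.
- by apply: etrans e11; ring.
- by apply: etrans e20; rewrite /hirota3; ring.
- by rewrite t0; ring.
- by rewrite -derivM t0 !dE; ring.
- by apply: etrans d20; rewrite /hirota2; ring.
- by apply: etrans (d0 _ d20); rewrite !dE; ring.
- by rewrite /hirota3; ring.
Qed.

(** If [g] vanished at [x] to order k + 2, the term of order k of the bilinear equation would be (k
    + 2)(k + 1) q(x) f(x), where q is the cofactor of [g]; this is nonzero. *)
Lemma simple_root_hirota2 f g (x : K) : g != 0 ->
  hirota2 g f = 0 -> root g x -> f.[x] != 0 -> g^`().[x] != 0.
Proof.
move=> g0 e rgx fx.
have [m [q + gE]] := multiplicity_XsubC g x; rewrite g0 /= => rq.
have d1 : (1 : {poly K})^`() = 0 := derivC 1.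
case: m => [|[|k]] in gE.
- by rewrite gE expr0 mulr1 (negPf rq) in rgx.
- rewrite gE expr1 derivM derivXsubC hornerD !hornerM !hornerE subrr.
  by rewrite mulr0 add0r.
move: gE; set Y := 'X - x%:P => gE.
have dY : Y^`() = 1 by rewrite derivXsubC.
have Y0 : Y != 0 by rewrite polyXsubC_eq0.
have Yx : Y.[x] = 0 by rewrite !hornerE subrr.
clearbody Y; pose P := Y ^+ k.
pose a : {poly K} := k.+2%:R; pose b : {poly K} := k.+1%:R.
have dXn m : (Y ^+ m.+1)^`() = m.+1%:R * Y ^+ m.
  by rewrite deriv_exp dY mul1r mulr_natl.
have dn m : (m%:R : {poly K})^`() = 0 by rewrite -polyC_natr derivC.
have g1E : g^`() = (a * q + Y * q^`()) * (Y * P).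
  rewrite gE derivM dXn -/a exprSr exprS -/P; ring.
have g2E : g^`()^`() =
    (a * b * q + Y * ((a + 1 + b) * q^`() + Y * q^`()^`())) * P.
  rewrite g1E -exprS !derivM derivD !derivM dXn dY dn exprS -/P -/b; ring.
(* The bilinear equation after division by the common factor [P]; at [x] only its first product
   survives. *)
have E : (a * b * q + Y * ((a + 1 + b) * q^`() + Y * q^`()^`())) * f
   - (Y * (a * q + Y * q^`()) * f^`()) *+ 2 + Y ^+ 2 * q * f^`()^`() = 0.
  have P0 : P != 0 by rewrite expf_neq0.
  have gE2 : g = q * (Y * Y * P) by rewrite gE !exprS -(mulrA Y).
  apply: (mulfI P0); rewrite mulr0; apply: etrans e.
  by rewrite /hirota2 g2E g1E {1}gE2; ring.
have ax : a.[x] = k.+2%:R by rewrite /a -polyC_natr hornerC.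
have bx : b.[x] = k.+1%:R by rewrite /b -polyC_natr hornerC.
move: E; clearbody a b => /(congr1 (horner^~ x)).
rewrite !(hornerD, hornerN, hornerM, hornerMn, horner_exp) horner0 !Yx ?expr0n /=.
rewrite !(mul0r, mul0rn, subr0, addr0) => /eqP.
rewrite !mulf_eq0 (negPf fx) orbF ax bx !pnatr_eq0 /=.
by move: rq; rewrite /root => /negPf ->.
Qed.

(** Consequently a simple root of [g] is a root of neither [f] nor [h]. *)
Lemma toda_at_root f g h (x : K) :
  toda f g h -> root g x -> h.[x] * f.[x] = g^`().[x] ^+ 2 *+ 4.
Proof.
rewrite /toda -hornerM => -> /rootP gx.
rewrite !(hornerD, hornerN, hornerMn, hornerM, horner_exp) gx; ring.
Qed.

End Hirota.

(** * Nonvanishing, simple roots and rotational symmetry *)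

Section TodaSequences.
Variable C : numClosedFieldType.
Variable Q : nat -> {poly C}.
Hypotheses (Q0 : Q 0 = 1) (Q1 : Q 1 = 'X).
(* At n = 0 this reads Q_1 Q_0 = z Q_0^2 (as 0.-1 = 0), which is consistent with
   the convention Q_(-1) = 1. *)
Hypothesis QS : forall n, toda (Q n.-1) (Q n) (Q n.+1).

(** The four properties need one another in the induction. The absence of common roots makes the
    roots of [Q n] simple, and [toda_at_root] then separates them from those of [Q n.+1]. *)
Lemma yv_invariant n :
  [/\ Q n.-1 != 0, Q n != 0, backlund_pair n (Q n) (Q n.-1) &
  forall x, root (Q n) x -> (Q n.-1).[x] != 0].
Proof.
have d1 : (1 : {poly C})^`() = 0 := derivC 1.
elim: n => [|n [f0 g0 b c]].
  rewrite /= Q0 oner_neq0; split=> //.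
    by split; rewrite /hirota3 /hirota2 !(d1, deriv0); ring.
  by move=> x _; rewrite hornerC oner_neq0.
have t := QS n.
have h0 : Q n.+1 != 0.
  apply/eqP => h0.
  (* If [Q n.+1] were 0, a constant [Q n] = a would give z a^2 = 0, and a nonconstant one would have
     a root where its derivative vanishes. *)
  have [s1|s1] := eqVneq (size (Q n)) 1.
    have [a gE] : exists a, Q n = a%:P.
      by exists (Q n)`_0; apply: size1_polyC; rewrite s1.
    move: t; rewrite /toda h0 mul0r gE derivC deriv0 expr0n mulr0 subrr mul0rn.
    rewrite subr0 => /esym/eqP.
    by rewrite mulf_eq0 polyX_eq0 expf_eq0 /= -gE (negPf g0).
  have /closed_rootP [x rx] := s1.
  have /esym/eqP := toda_at_root t rx; rewrite h0 horner0 mul0r.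
  rewrite mulrn_eq0 expf_eq0 /=; apply/negP.
  by have [e _] := b; apply: simple_root_hirota2 e rx (c _ rx).
split=> //; first exact: backlund_pair_step t b.
move=> x rx; apply/negP => rg.
have /esym/eqP := toda_at_root t rg; rewrite (rootP rx) mul0r.
rewrite mulrn_eq0 expf_eq0 /=; apply/negP.
by have [e _] := b; apply: simple_root_hirota2 e rg (c _ rg).
Qed.

Lemma yv_neq0 n : Q n != 0. Proof. by have [] := yv_invariant n. Qed.

Lemma yv_backlund n : backlund_pair n (Q n) (Q n.-1).
Proof. by have [] := yv_invariant n. Qed.

Lemma yv_simple n x : root (Q n) x -> (Q n)^`().[x] != 0.
Proof.
move=> rx; have [_ g0 [e _] c] := yv_invariant n.
exact: simple_root_hirota2 e rx (c _ rx).
Qed.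

(** The substitution z -> w z multiplies the right-hand side of the recurrence by w; the exponent is
    n(n + 1)/2, the degree of [Q n]. *)
Lemma yv_rotation (w : C) n : w ^+ 3 = 1 ->
  Q n \Po (w *: 'X) = w ^+ 'C(n.+1, 2) *: Q n.
Proof.
move=> w3.
have w0 : w != 0.
  by apply/eqP => w0; move/eqP: w3; rewrite w0 expr0n eq_sym oner_eq0.
pose sc (p : {poly C}) := p \Po (w *: 'X).
(* The factor w^2 is the inverse of w. *)
have scD p : sc p^`() = w ^+ 2 *: (sc p)^`().
  rewrite /sc deriv_comp derivZ derivX -scalerAr mulr1 scalerA -exprSr w3.
  by rewrite scale1r.
have IH : forall m, sc (Q m) = w ^+ 'C(m.+1, 2) *: Q m /\
    sc (Q m.+1) = w ^+ 'C(m.+2, 2) *: Q m.+1.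
  elim=> [|k [IH1 IH2]].
    by rewrite Q0 Q1 /sc rmorph1 scale1r comp_polyX; split=> //.
  split=> //; have f0 : w ^+ 'C(k.+1, 2) *: Q k != 0.
    by rewrite scaler_eq0 negb_or expf_neq0 //= yv_neq0.
  have t := QS k.+1; rewrite /toda /= in t.
  have := congr1 sc t; rewrite /sc.
  have s1 : sc (Q k.+1)^`() = w ^+ 2 *: (w ^+ 'C(k.+2, 2) *: (Q k.+1)^`()).
    by rewrite scD IH2 derivZ.
  have s2 : sc (Q k.+1)^`()^`() =
      w ^+ 2 *: (w ^+ 2 *: (w ^+ 'C(k.+2, 2) *: (Q k.+1)^`()^`())).
    by rewrite scD s1 !derivZ.
  rewrite /sc in IH1 IH2 s1 s2 *.
  rewrite !(rmorphB, rmorphMn, rmorphM, rmorphXn) /= comp_polyX s1 s2 IH1 IH2 => E.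
  apply: (mulIf f0); rewrite {}E.
  have c2 : w ^+ 'C(k.+2, 2) = w ^+ 'C(k.+1, 2) * w ^+ k.+1.
    by rewrite (binS k.+1) bin1 exprD.
  have c3 : w ^+ 'C(k.+3, 2) = w ^+ 'C(k.+2, 2) * (w ^+ k.+1 * w).
    by rewrite (binS k.+2) bin1 exprD -exprSr.
  rewrite c3 c2 -[RHS]scalerAl -[_ * (_ *: Q k)]scalerAr t.
  move: w3; rewrite -!mul_polyC.
  move: (w ^+ k.+1) (w ^+ 'C(k.+1, 2)) (Q k.+1) => u b g w3'.
  have {}w3 : w%:P ^+ 3 - 1 = 0 by rewrite -polyC_exp w3' subrr.
  (* The terms with derivatives carry w^4 instead of w, so the two sides differ by a multiple of w^3
     - 1. *)
  pose c := - w%:P * b%:P ^+ 2 * u%:P ^+ 2 * (g * g^`()^`() - g^`() ^+ 2) *+ 4.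
  have e : (w%:P ^+ 3 - 1) * c = 0 by rewrite w3 mul0r.
  rewrite !polyCM; apply: (eq_via0 (esym (esym e))); rewrite /c.
  ring.
by have [] := IH n.
Qed.

Lemma cube_root_unity : exists2 w : C, w ^+ 3 = 1 & w != 1.
Proof.
have s : size ('X ^+ 2 + 'X + 1 : {poly C}) != 1.
  by rewrite -addrA size_polyDl size_polyXn // -[1]polyC1 size_XaddC.
have /closed_rootP [w] := s.
rewrite /root !hornerE => /eqP e; exists w.
  apply/eqP; rewrite -subr_eq0; apply/eqP.
  by rewrite -[RHS](mulr0 (w - 1)) -e; ring.
apply/eqP => w1; have /eqP : (3 : C) = 0 by rewrite -e w1; ring.
by rewrite pnatr_eq0.
Qed.

Lemma yv_root_rotation (w : C) n x : w ^+ 3 = 1 -> root (Q n) x -> root (Q n) (w * x).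
Proof.
move=> w3 rx; have := congr1 (horner^~ x) (yv_rotation n w3).
by rewrite horner_comp !hornerZ hornerX (rootP rx) mulr0 /root => ->.
Qed.

Lemma bin2_mod3 n : ('C(n.+1, 2) %% 3 = (n %% 3 == 1))%N.
Proof.
elim/ltn_ind: n => [[|[|[|n]]]] // IH.
have -> : 'C(n.+4, 2) = (n.+2 * 3 + 'C(n.+1, 2))%N by rewrite !binS !bin1 !bin0; lia.
by rewrite modnMDl IH; [rewrite -(addn3 n) modnDr | rewrite -addn3; lia].
Qed.

(** If n = 1 mod 3, rotation gives Q_n(0) = w Q_n(0), hence a root at 0. Otherwise it gives Q_n'(0)
    = w Q_n'(0), so Q_n'(0) = 0, and a root at 0 would not be simple. *)
Lemma yv_root0 n : root (Q n) 0 = (n %% 3 == 1)%N.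
Proof.
have [w w3 w1] := cube_root_unity.
have e : w ^+ 'C(n.+1, 2) = w ^+ (n %% 3 == 1)%N.
  by rewrite -(expr_mod _ w3) bin2_mod3.
have rot := yv_rotation n w3; rewrite e in rot.
case: eqP e rot => /= [_ _|_ _]; rewrite ?expr1 ?expr0 ?scale1r => rot.
  have := congr1 (horner^~ 0) rot; rewrite horner_comp !hornerZ hornerX mulr0.
  move/eqP; rewrite -subr_eq0 -{1}[_.[0]]mul1r -mulrBl mulf_eq0 subr_eq0 eq_sym.
  by rewrite (negPf w1) => /eqP/rootP ->.
apply/negP => r0; have := yv_simple r0.
have := congr1 (horner^~ 0 \o deriv) rot; rewrite /= deriv_comp derivZ derivX.
rewrite hornerM horner_comp !hornerZ hornerX mulr0 hornerC mulr1.
move/eqP; rewrite -subr_eq0 -{2}[_.[0]]mulr1 -mulrBr mulf_eq0 subr_eq0.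
by rewrite (negPf w1) orbF => ->.
Qed.
End TodaSequences.

(** * Truncated logarithmic derivatives and coefficient recursions *)

Section Series.
Variable K : numFieldType.
Implicit Types p f g G F U : {poly K}.

(* Unlike p'/p, the quotient (theta p)/p is regular at 0 even if p(0) = 0. *)
Definition theta p := 'X * p^`().

Lemma coef_theta p k : (theta p)`_k = p`_k *+ k.
Proof. by rewrite /theta coefXM coef_deriv; case: k. Qed.

(** Unlike the derivative, [theta] preserves multiples of z^N, so no precision is lost when
    congruences are differentiated. *)
Lemma theta_Xn N p : theta ('X^N * p) = 'X^N * (p *+ N + theta p).
Proof.
rewrite /theta derivM derivXn mulrDr mulrA.
case: N => [|N]; first by rewrite !expr0 /=; ring.
rewrite exprS /=; move: ('X^N) => y.
by ring.
Qed.

Lemma thetaM p q : theta (p * q) = theta p * q + p * theta q.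
Proof. by rewrite /theta derivM; ring. Qed.

(** [G] represents (theta p)/p up to order [N]; the denominator is cleared because [p] may vanish at
    0. *)
Definition log_derivative_mod N p G := exists a, theta p = G * p + 'X^N * a.

Lemma theta2_mod N p G : log_derivative_mod N p G ->
  exists a, 'X^2 * p^`()^`() = (theta G + G ^+ 2 - G) * p + 'X^N * a.
Proof.
case=> a e; have := congr1 theta e.
have -> : theta ( theta p) = theta p + 'X^2 * p^`()^`().
  by rewrite /theta derivM derivX; ring.
rewrite /theta derivD -!/(theta _) mulrDr -!/(theta _) theta_Xn thetaM e => e2.
exists (a *+ N + theta a + G * a - a); apply: (addrI (theta p)); rewrite e e2.
by move: ('X^N) => y; ring.
Qed.

Lemma theta3_mod N p G : log_derivative_mod N p G ->
  exists a, 'X^3 * p^`()^`()^`() =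
    (theta (theta G + G ^+ 2 - G) + (theta G + G ^+ 2 - G) * (G - 2)) * p
    + 'X^N * a.
Proof.
move=> h; have [b e2] := theta2_mod h; have [a e1] := h.
move: (theta G + _ - _) e2 => H e2.
have := congr1 theta e2.
have -> : theta ('X^2 * p^`()^`()) =
    'X^2 * p^`()^`() *+ 2 + 'X^3 * p^`()^`()^`().
  by rewrite /theta derivM derivXn; ring.
rewrite /theta derivD -!/(theta _) mulrDr -!/(theta _) theta_Xn thetaM e1 => e3.
exists (b *+ N + theta b + H * a - b *+ 2).
apply: (addrI ('X^2 * p^`()^`() *+ 2)).
by rewrite e3 e2; move: ('X^N) => y; ring.
Qed.

Lemma thetaN p : theta (- p) = - theta p.
Proof. by rewrite /theta derivN mulrN. Qed.

Lemma thetaD p q : theta (p + q) = theta p + theta q.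
Proof. by rewrite /theta derivD mulrDr. Qed.

Lemma theta_riccati G :
  theta (theta G + G ^+ 2 - G) = theta (theta G) + (G * theta G) *+ 2 - theta G.
Proof. by rewrite !thetaD thetaN expr2 thetaM; ring. Qed.

(* In terms of u and s, U = z u and S = z s up to the truncation. *)
Lemma backlund_pair_log N n f g F G :
  log_derivative_mod N f F -> log_derivative_mod N g G -> backlund_pair n g f ->
  let U := G - F in let S := G + F in
  ('X^N %| f * g * (theta S - S + U ^+ 2)) /\
  ('X^N %| f * g * (theta (theta U) - theta U *+ 3 + U *+ 2
      + U * (theta S - S) *+ 3 + U ^+ 3 - 'X^3 * U + 'X^3 *+ n)).
Proof.
move=> lf lg [e1 e2] U S.
have [f1 F1] := lf; have [f2 F2] := theta2_mod lf; have [f3 F3] := theta3_mod lf.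
have [g1 G1] := lg; have [g2 G2] := theta2_mod lg; have [g3 G3] := theta3_mod lg.
rewrite theta_riccati in F3; rewrite theta_riccati in G3.
rewrite /U /S !(thetaD, thetaN).
(* The bilinear equations are multiplied by z^2 and z^3, so that each derivative of order j comes
   with its factor z^j. *)
have E1 : ('X^2 * g^`()^`()) * f - (theta g * theta f) *+ 2
    + g * ('X^2 * f^`()^`()) = 0.
  by rewrite -[RHS](mulr0 'X^2) -e1 /hirota2 /theta; ring.
have E2 : 'X^3 * g^`()^`()^`() * f - ('X^2 * g^`()^`() * theta f) *+ 3
  + (theta g * ('X^2 * f^`()^`())) *+ 3 - g * ('X^3 * f^`()^`()^`()) -
  'X^3 * (theta g * f - g * theta f) + 'X^3 * (g * f) *+ n = 0.
  by rewrite -[RHS](mulr0 'X^3) -e2 /hirota3 /theta; ring.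
rewrite F1 F2 G1 G2 in E1; rewrite F1 F2 G1 G2 F3 G3 in E2.
move: (theta (theta F)) (theta (theta G)) (theta F) (theta G)
  {lf lg F1 F2 F3 G1 G2 G3 e1 e2} E1 E2.
move: ('X^N) => y F'' G'' F' G' E1 E2; split.
  apply/dvdpP.
  exists (- (g2 * f - (G * g * f1 + F * f * g1 + y * g1 * f1) *+ 2 + g * f2)).
  by apply: (eq_via0 E1); ring.
apply/dvdpP.
exists (- (g3 * f - ((G' + G ^+ 2 - G) * g * f1 + g2 * F * f + y * g2 * f1) *+ 3
  + (G * g * f2 + g1 * (F' + F ^+ 2 - F) * f + y * g1 * f2) *+ 3 - g * f3
  - 'X^3 * (g1 * f - g * f1))).
by apply: (eq_via0 E2); ring.
Qed.

Lemma dvdp_cancel N f p : f.[0] != 0 -> 'X^N %| f * p -> 'X^N %| p.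
Proof.
move=> f0; rewrite Gauss_dvdpr // coprimep_expl // coprimep_sym.
by rewrite -['X]subr0 -polyC0 coprimep_XsubC.
Qed.

(** At most one factor z of [g] has to be removed, at the cost of one order; the remaining cofactor
    is coprime to z. *)
Lemma dvdp_cancel_simple N g p : (root g 0 -> g^`().[0] != 0) ->
  'X^(N.+1) %| g * p -> 'X^N %| p.
Proof.
have [/factor_theorem [q qE] | g0 _] := boolP (root g 0); last first.
  by move=> /(dvdp_cancel g0); apply: dvdp_trans; rewrite exprS dvdp_mull.
rewrite subr0 in qE; rewrite qE derivM derivX hornerD !hornerM hornerX hornerC.
rewrite mulr0 add0r mulr1.
move=> /(_ isT) q0; rewrite exprSr mulrAC dvdp_mul2r ?polyX_eq0 //.
exact: dvdp_cancel.
Qed.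

Lemma dvdp_Xn_coef N p k : 'X^N %| p -> (k < N)%N -> p`_k = 0.
Proof. by move=> /dvdpP [q ->] kN; rewrite coefMXn kN. Qed.

(** Since [theta] multiplies the coefficient of z^k by k, the operator theta^2 - 3 theta + 2 becomes
    (k - 1)(k - 2). The extra order in the hypotheses pays for a possible zero of [g] at 0. *)
Lemma backlund_pair_coef N n f g F G :
  f.[0] != 0 -> (root g 0 -> g^`().[0] != 0) ->
  log_derivative_mod N.+1 f F -> log_derivative_mod N.+1 g G ->
  backlund_pair n g f ->
  forall k, (k < N)%N -> let U := G - F in let S := G + F in
  (k%:R - 1) * S`_k = - (U ^+ 2)`_k /\
  (k%:R - 1) * (k%:R - 2) * U`_k =
    (U ^+ 3)`_k *+ 2 + ('X^3 * U)`_k - n%:R * (k == 3)%:R.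
Proof.
move=> f0 g0 lf lg b k kN U S.
have [e1 e2] := backlund_pair_log lf lg b; rewrite -/U -/S in e1 e2.
rewrite -(mulrA f g) in e1; rewrite -(mulrA f g) in e2.
have {}e1 := dvdp_cancel_simple g0 (dvdp_cancel f0 e1).
have {}e2 := dvdp_cancel_simple g0 (dvdp_cancel f0 e2).
(* Subtracting 3 U times the first relation eliminates [S] and leaves Painleve II. *)
have e3 : 'X^N %| theta (theta U) - theta U *+ 3 + U *+ 2 - U ^+ 3 *+ 2
    - 'X^3 * U + 'X^3 *+ n.
  have -> : theta (theta U) - theta U *+ 3 + U *+ 2 - U ^+ 3 *+ 2
      - 'X^3 * U + 'X^3 *+ n =
    (theta (theta U) - theta U *+ 3 + U *+ 2 + U * (theta S - S) *+ 3
      + U ^+ 3 - 'X^3 * U + 'X^3 *+ n) - (U *+ 3) * (theta S - S + U ^+ 2) by ring.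
  by apply: dvdp_sub => //; apply: dvdp_mull.
split.
  have := dvdp_Xn_coef e1 kN; rewrite !(coefD, coefN, coef_theta) => e.
  by apply: (eq_via0 e); ring.
have := dvdp_Xn_coef e3 kN.
rewrite !(coefD, coefN, coefMn, coef_theta) coefXn => e.
by apply: (eq_via0 e); ring.
Qed.
End Series.

(** * Logarithmic derivatives of products of linear factors *)

Section LogDerivativeProducts.
Variable K : numFieldType.
Implicit Types p q F G : {poly K}.

Lemma log_derivative_modM N p q F G :
  log_derivative_mod N p F -> log_derivative_mod N q G ->
  log_derivative_mod N (p * q) (F + G).
Proof.
move=> [a ea] [b eb]; exists (a * q + p * b); rewrite thetaM ea eb.
by move: 'X^N => y; ring.
Qed.

Lemma log_derivative_modZ N c p F :
  log_derivative_mod N p F -> log_derivative_mod N (c *: p) F.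
Proof.
move=> [a ea]; exists (c *: a); rewrite /theta derivZ -scalerAr -/(theta p) ea.
by rewrite scalerDr !scalerAr.
Qed.

(* For z = 0 the sum vanishes, since 0^-1 = 0. *)
Definition log_derivative_linear M (z : K) : {poly K} :=
  (z == 0)%:R%:P - \sum_(k < M) z ^- k.+1 *: 'X^(k.+1).

Lemma log_derivative_mod_linear M z :
  log_derivative_mod M.+1 ('X - z%:P) (log_derivative_linear M z).
Proof.
rewrite /log_derivative_mod /theta derivXsubC mulr1 /log_derivative_linear.
have [->|z0] := eqVneq z 0.
  exists 0; rewrite big1 => [|k _]; last by rewrite exprS mul0r invr0 scale0r.
  by rewrite !subr0 mulr0 mul1r addr0.
(* X/(X - z) is minus the geometric series in X/z without its constant term; this witness is the
   coefficient of the remainder. *)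
exists (z ^- M)%:P; rewrite sub0r.
elim: M => [|M IH]; first by rewrite big_ord0 expr0 invr1; ring.
rewrite big_ord_recr /= opprD mulrDl {1}IH -mul_polyC.
have -> : z ^- M = z * z ^- M.+1 by rewrite exprS invfM mulVKf.
rewrite polyCM (exprS 'X M.+1); move: ('X^(M.+1)) (z ^- M.+1)%:P => y u.
by ring.
Qed.

Lemma log_derivative_mod_prod M (rs : seq K) :
  log_derivative_mod M.+1 (\prod_(z <- rs) ('X - z%:P))
    (\sum_(z <- rs) log_derivative_linear M z).
Proof.
elim: rs => [|z rs IH].
  by rewrite !big_nil; exists 0; rewrite /theta (derivC 1) !mulr0 mul0r addr0.
rewrite !big_cons; apply: log_derivative_modM => //.
exact: log_derivative_mod_linear.
Qed.

End LogDerivativeProducts.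

(** * Polynomial dependence on n with rational coefficients *)

Section RatPoly.
Variable K : numFieldType.
Implicit Types (D : pred nat) (h : nat -> K).

Definition rat_poly_on D h :=
  exists P : {poly rat}, forall n, D n -> h n = ratr P.[n%:R].

Lemma rat_poly_on_ext D h1 h2 :
  (forall n, D n -> h1 n = h2 n) -> rat_poly_on D h2 -> rat_poly_on D h1.
Proof. by move=> e [P hP]; exists P => n Dn; rewrite e ?hP. Qed.

Lemma rat_poly_on_const D (c : rat) : rat_poly_on D (fun=> ratr c).
Proof. by exists c%:P => n _; rewrite hornerC. Qed.

Lemma rat_poly_on_nat D : rat_poly_on D (fun n => n%:R).
Proof. by exists 'X => n _; rewrite hornerX ratr_nat. Qed.

Lemma rat_poly_onD D h1 h2 : rat_poly_on D h1 -> rat_poly_on D h2 ->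
  rat_poly_on D (fun n => h1 n + h2 n).
Proof.
move=> [P hP] [P' hP']; exists (P + P') => n Dn.
by rewrite hornerD rmorphD /= hP ?hP'.
Qed.

Lemma rat_poly_onM D h1 h2 : rat_poly_on D h1 -> rat_poly_on D h2 ->
  rat_poly_on D (fun n => h1 n * h2 n).
Proof.
move=> [P hP] [P' hP']; exists (P * P') => n Dn.
by rewrite hornerM rmorphM /= hP ?hP'.
Qed.

Lemma rat_poly_on_cancel D (c : rat) h : c != 0 ->
  rat_poly_on D (fun n => ratr c * h n) -> rat_poly_on D h.
Proof.
move=> c0 hc.
apply: rat_poly_on_ext (rat_poly_onM (rat_poly_on_const D c^-1) hc) => n _.
by rewrite mulrA -rmorphM /= mulVf // rmorph1 mul1r.
Qed.

Lemma rat_poly_on_sum D (I : finType) (h : I -> nat -> K) :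
  (forall i, rat_poly_on D (h i)) -> rat_poly_on D (fun n => \sum_i h i n).
Proof.
move=> hh; rewrite /index_enum; elim: (Finite.enum I) => [|i s IH] //=.
  by exists 0 => n _; rewrite big_nil horner0 rmorph0.
apply: rat_poly_on_ext (rat_poly_onD (hh i) IH) => n _; by rewrite big_cons.
Qed.

Lemma rat_poly_on0 D h : (forall n, D n -> h n = 0) -> rat_poly_on D h.
Proof. by move=> h0; exists 0 => n Dn; rewrite horner0 rmorph0 h0. Qed.

Lemma rat_poly_on_coefM D (A B : nat -> {poly K}) k :
  (forall j, (j <= k)%N -> rat_poly_on D (fun n => (A n)`_j)) ->
  (forall j, (j <= k)%N -> rat_poly_on D (fun n => (B n)`_j)) ->
  rat_poly_on D (fun n => (A n * B n)`_k).
Proof.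
move=> hA hB.
apply: (@rat_poly_on_ext _ _
  (fun n => \sum_(j < k.+1) (A n)`_j * (B n)`_(k - j))).
  by move=> n _; rewrite coefM.
apply: rat_poly_on_sum => j.
apply: rat_poly_onM; first by apply: hA; rewrite -ltnS.
by apply: hB; rewrite leq_subr.
Qed.

(** The two extreme terms of the convolution vanish with the constant terms, so only indices below
    [k] matter. This keeps the nonlinear terms of the recursion within reach of the induction
    hypothesis. *)
Lemma rat_poly_on_coefM_lower D (A B : nat -> {poly K}) k :
  (forall n, D n -> (A n)`_0 = 0) -> (forall n, D n -> (B n)`_0 = 0) ->
  (forall j, (j < k)%N -> rat_poly_on D (fun n => (A n)`_j)) ->
  (forall j, (j < k)%N -> rat_poly_on D (fun n => (B n)`_j)) ->
  rat_poly_on D (fun n => (A n * B n)`_k).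
Proof.
move=> A0 B0 hA hB.
apply: (@rat_poly_on_ext _ _
  (fun n => \sum_(j < k.+1) (A n)`_j * (B n)`_(k - j))).
  by move=> n _; rewrite coefM.
apply: rat_poly_on_sum => -[j /= jk].
have [->|j0] := eqVneq j 0.
  by apply: rat_poly_on0 => n Dn; rewrite A0 ?mul0r.
have [->|jk'] := eqVneq j k.
  by apply: rat_poly_on0 => n Dn; rewrite subnn B0 ?mulr0.
by apply: rat_poly_onM; [apply: hA | apply: hB]; lia.
Qed.

(* Writing U = e + W, the linear part of U^3 moves to the left and the
   coefficient of U_k becomes (k - 1)(k - 2) - 6 e, whose natural zeros are
   1, 2 for e = 0 and 4 for e = 1. *)
Lemma recursion_rat_poly D (e : bool) M (U : nat -> {poly K}) :
  (forall n, D n -> (U n)`_0 = e%:R) ->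
  (forall n k, D n -> (k < M)%N -> ~~ (3 %| k)%N -> (U n)`_k = 0) ->
  (forall n k, D n -> (k < M)%N -> (k%:R - 1) * (k%:R - 2) * (U n)`_k =
     (U n ^+ 3)`_k *+ 2 + ('X^3 * U n)`_k - n%:R * (k == 3)%:R) ->
  forall k, (k < M)%N -> rat_poly_on D (fun n => (U n)`_k).
Proof.
move=> U0 Uz Urec; elim/ltn_ind => k IH kM.
have [dk|ndk] := boolP (3 %| k)%N; last first.
  by apply: rat_poly_on0 => n Dn; apply: Uz.
have [->|k0] := eqVneq k 0.
  apply: rat_poly_on_ext U0 _.
  by exists e%:R%:P => n _; rewrite hornerC ratr_nat.
pose E : {poly K} := e%:R%:P.
pose W n := U n - E.
have Wk n j : j != 0 -> (W n)`_j = (U n)`_j.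
  by move=> j0; rewrite coefB coefC (negPf j0) subr0.
have W0 n : D n -> (W n)`_0 = 0.
  by move=> Dn; rewrite coefB coefC eqxx U0 ?subrr.
have hW j : (j < k)%N -> rat_poly_on D (fun n => (W n)`_j).
  move=> jk; have [->|j0] := eqVneq j 0; first exact: rat_poly_on0.
  by apply: rat_poly_on_ext (IH _ jk _) => [n _|]; [exact: Wk | lia].
have hW2 j : (j <= k)%N -> rat_poly_on D (fun n => (W n * W n)`_j).
  by move=> jk; apply: rat_poly_on_coefM_lower => // i ij; apply: hW; lia.
have W20 n : D n -> (W n * W n)`_0 = 0 by move=> Dn; rewrite coef0M W0 ?mul0r.
have hW3 : rat_poly_on D (fun n => (W n * (W n * W n))`_k).
  by apply: rat_poly_on_coefM_lower => // j jk; apply: hW2; lia.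
have hX : rat_poly_on D (fun n => ('X^3 * U n)`_k).
  apply: (@rat_poly_on_ext _ _ (fun n => (U n)`_(k - 3))) => [n _|].
    by rewrite coefXnM ltnNge dvdn_leq ?lt0n.
  by apply: IH; lia.
pose c : rat := (k%:R - 1) * (k%:R - 2) - (6 * e)%:R.
(* Here [k] is a nonzero multiple of 3, hence none of the zeros 1, 2, 4. *)
have c0 : c != 0.
  rewrite /c; case: (e); last first.
    rewrite muln0 subr0 mulf_eq0 !subr_eq0 !(eqr_nat _ _ 1) !eqr_nat; lia.
  have -> : (k%:R - 1) * (k%:R - 2) - (6 * true)%:R = (k%:R - 4) * (k%:R + 1) :> rat.
    by rewrite muln1; ring.
  rewrite mulf_eq0 subr_eq0 natr1 eqr_nat pnatr_eq0; lia.
apply: (rat_poly_on_cancel c0).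
have cst q : rat_poly_on D (fun=> ratr q) := rat_poly_on_const D q.
apply: rat_poly_on_ext
  (rat_poly_onD (rat_poly_onD (rat_poly_onM (cst (6 * e)%:R) (hW2 k (leqnn k)))
     (rat_poly_onM (cst 2) hW3))
   (rat_poly_onD hX
     (rat_poly_onM (rat_poly_on_nat D) (cst (- (k == 3)%:R))))) => n Dn.
have := Urec n k Dn kM.
(* In the expansion of (W + E)^3, the powers of [E] collapse because [e] is 0 or 1 and so E^2 =
   E. *)
have UE : U n ^+ 3 = (3 * e%:R) *: (W n + W n * W n) + E + W n * (W n * W n).
  rewrite -mul_polyC polyCM -/E polyC_natr.
  have EE : E ^+ 2 - E = 0.
    by rewrite /E -polyC_exp -natrX; case: (e); rewrite subrr.
  have -> : U n = W n + E by rewrite subrK.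
  move: (W n) => w.
  have e2 : (E ^+ 2 - E) * (w *+ 3 + E + 1) = 0 by rewrite EE mul0r.
  by apply: (eq_via0 e2); ring.
rewrite {1}UE !coefD coefZ coefD coefC (negPf k0) addr0 Wk // => h.
rewrite rmorphN /= !ratr_nat /c rmorphB rmorphM !rmorphB /= !ratr_nat rmorph1.
move: h; rewrite natrM; move: (e%:R) (n%:R) (k == 3)%:R => ee nn kk h.
apply: (eq_via0 (e := (k%:R - 1) * (k%:R - 2) * (U n)`_k
  - ((3 * ee * ((U n)`_k + (W n * W n)`_k) + (W n * (W n * W n))`_k) *+ 2
    + ('X^3 * U n)`_k - nn * kk))).
  by rewrite h subrr.
ring.
Qed.

End RatPoly.

(** * Power sums of the nonzero roots *)

Section PowerSums.
Variable R : realType.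
Local Notation C := R[i].
Implicit Types p : {poly C}.

(** A repeated entry in the list of roots would be a common zero of the product and its derivative.
    The hypothesis passes to the tail because the other term of the product rule vanishes at a root
    of the tail. *)
Lemma simple_factorization p : p != 0 ->
  (forall x, root p x -> p^`().[x] != 0) ->
  exists2 rs : seq C, uniq rs & p = lead_coef p *: \prod_(z <- rs) ('X - z%:P).
Proof.
move=> p0 simple; have [rs pE] := closed_field_poly_normal p; exists rs => //.
have l0 : lead_coef p != 0 by rewrite lead_coef_eq0.
have : forall x, root (\prod_(z <- rs) ('X - z%:P)) x ->
    (\prod_(z <- rs) ('X - z%:P))^`().[x] != 0.
  move=> x rx; have := simple x.
  by rewrite pE derivZ hornerZ rootZ // mulf_eq0 negb_or l0; apply.
elim: (rs) => //= z s IH; rewrite !big_cons derivM derivXsubC mul1r => h.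
have zs : z \notin s.
  apply/negP => zs; have /h : root (('X - z%:P) * \prod_(j <- s) ('X - j%:P)) z.
    by rewrite rootM root_XsubC eqxx.
  rewrite !hornerE.
  have /rootP -> : root (\prod_(j <- s) ('X - j%:P)) z by rewrite root_prod_XsubC.
  by rewrite subrr mul0r addr0 eqxx.
rewrite zs /= IH // => x rx; have := h x.
rewrite rootM rx orbT hornerD hornerM (rootP rx) add0r mulf_eq0 negb_or.
move=> /(_ isT).
by case/andP.
Qed.

Lemma root_power_sumE p (rs : seq C) m : uniq rs -> root p =i rs ->
  root_power_sum p m = \sum_(z <- rs | z != 0) z ^- m.
Proof.
move=> urs prs.
rewrite /root_power_sum -[RHS]big_filter [RHS]fsbig_seq ?filter_uniq //.
apply: eq_fsbigl; apply/seteqP; split=> z /=.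
  by move=> [rz z0]; rewrite mem_filter z0 -prs.
by rewrite mem_filter -prs => /andP[].
Qed.

(** For [p] with simple roots, this is the Taylor expansion of z p'/p at 0 up to order [M]; its
    constant term is the multiplicity of the root 0. *)
Definition root_series M p : {poly C} :=
  (root p 0)%:R%:P - \sum_(k < M) root_power_sum p k.+1 *: 'X^(k.+1).

Lemma coef0_root_series M p : (root_series M p)`_0 = (root p 0)%:R.
Proof.
rewrite coefB coefC eqxx coef_sum big1 ?subr0 // => k _.
by rewrite coefZ coefXn mulr0.
Qed.

Lemma coef_root_series M p k : (0 < k <= M)%N ->
  (root_series M p)`_k = - root_power_sum p k.
Proof.
case: k => [//|k] /= kM; rewrite coefB coefC sub0r coef_sum.
rewrite (bigD1 (Ordinal kM)) //= coefZ coefXn eqxx mulr1 big1 ?addr0 // => j jk.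
rewrite coefZ coefXn eqSS; case: eqP => [e|]; last by rewrite mulr0.
by case/eqP: jk; apply: val_inj.
Qed.

Lemma log_derivative_root_series M p : p != 0 ->
  (forall x, root p x -> p^`().[x] != 0) ->
  log_derivative_mod M.+1 p (root_series M p).
Proof.
move=> p0 simple; have [rs urs pE] := simple_factorization p0 simple.
have prs : root p =i rs.
  by move=> x; rewrite pE -topredE /= rootZ ?lead_coef_eq0 // root_prod_XsubC.
rewrite {1}pE; apply: log_derivative_modZ.
suff -> : root_series M p = \sum_(z <- rs) log_derivative_linear M z.
  exact: log_derivative_mod_prod.
rewrite /log_derivative_linear sumrB /root_series; congr (_ - _).
  rewrite -[root p 0]/(0 \in root p) prs -count_uniq_mem // -sum1_count natr_sum.
  rewrite big_mkcond /= raddf_sum /=; apply: eq_bigr => z _.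
  by case: eqP => // _; rewrite polyC0.
rewrite exchange_big /=; apply: eq_bigr => k _.
rewrite (root_power_sumE _ urs prs) -scaler_suml big_mkcond /=; congr (_ *: _).
apply: eq_bigr => z _; case: eqP => //= ->.
by rewrite exprS mul0r invr0.
Qed.

(** Exponent 0 counts the nonzero roots. It is a multiple of 3 outside the range of (a), so (c)
    needs it separately. *)
Lemma root_power_sum0_nat p : p != 0 ->
  (forall x, root p x -> p^`().[x] != 0) ->
  exists k : nat, root_power_sum p 0 = k%:R.
Proof.
move=> p0 simple; have [rs urs pE] := simple_factorization p0 simple.
have prs : root p =i rs.
  by move=> x; rewrite pE -topredE /= rootZ ?lead_coef_eq0 // root_prod_XsubC.
exists (count (fun z => z != 0) rs); rewrite (root_power_sumE _ urs prs).
by rewrite -sum1_count natr_sum; apply: eq_bigr => z _; rewrite expr0 invr1.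
Qed.

(** Reindexing the sum by z -> w z multiplies it by w^(-m), which differs from 1. *)
Lemma root_power_sum_rotation p (w : C) m : p != 0 ->
  (forall x, root p x -> p^`().[x] != 0) -> w != 0 ->
  (forall x, root p x -> root p (w * x)) -> w ^+ m != 1 ->
  root_power_sum p m = 0.
Proof.
move=> p0 simple w0 rot wm; have [rs urs pE] := simple_factorization p0 simple.
have prs : root p =i rs.
  by move=> x; rewrite pE -topredE /= rootZ ?lead_coef_eq0 // root_prod_XsubC.
rewrite (root_power_sumE _ urs prs); set s := \sum_(z <- rs | _) _.
have perm : perm_eq [seq w * x | x <- rs] rs.
  have us : uniq [seq w * x | x <- rs] by rewrite map_inj_uniq //; apply: mulfI.
  (* The rotated list has distinct entries, lies in [rs] and has the same length, so it exhausts
     [rs]. *)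
  apply: uniq_perm => //; apply: (uniq_min_size us _ _).2; last by rewrite size_map.
  by move=> _ /mapP [x xs ->]; rewrite -prs; apply: rot; rewrite [root p x]prs.
have : s = w ^- m * s.
  rewrite {1}/s -(perm_big _ perm) /= big_map mulr_sumr.
  apply: eq_big => [x|x _]; first by rewrite mulf_eq0 (negPf w0).
  by rewrite exprMn invfM.
move/eqP; rewrite -subr_eq0 -{1}[s]mul1r -mulrBl mulf_eq0 subr_eq0.
move=> /orP[|/eqP //].
by rewrite eq_sym invr_eq1 (negPf wm).
Qed.
End PowerSums.

(** * Application to the Yablonskii-Vorob'ev polynomials *)

Section YablonskiiVorobev.
Variables (R : realType) (Q : nat -> {poly R[i]}).
Hypothesis hQ : yablonskii_vorobev Q.

Lemma yv_toda n : toda (Q n.-1) (Q n) (Q n.+1).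
Proof.
have [Q0 Q1 QS] := hQ; rewrite /toda; case: n => [|n].
  by rewrite /= Q0 Q1 !(derivC 1) deriv0; ring.
by rewrite QS // mulr_natl.
Qed.

Let Q0 : Q 0 = 1. Proof. by case: hQ. Qed.
Let Q1 : Q 1 = 'X. Proof. by case: hQ. Qed.
Let Qn0 n : Q n != 0 := yv_neq0 Q0 yv_toda n.
Let Qsimple n := @yv_simple _ Q Q0 yv_toda n.

Lemma yv_root_power_sum_eq0 n m : ~~ (3 %| m)%N -> root_power_sum (Q n) m = 0.
Proof.
move=> nm; have [w w3 w1] := cube_root_unity R[i].
have w0 : w != 0.
  by apply/eqP => w0; move/eqP: w3; rewrite w0 expr0n eq_sym oner_eq0.
apply: (@root_power_sum_rotation _ _ w) => //; first exact: Qsimple.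
  by move=> x; apply: yv_root_rotation => //; apply: yv_toda.
rewrite -(expr_mod _ w3); have : (m %% 3 < 3)%N by rewrite ltn_mod.
move: nm; rewrite /dvdn; case: (m %% 3)%N => [|[|[|]]] // _ _.
by apply/eqP => w2; case/eqP: w1; rewrite -w3 exprS w2 mulr1.
Qed.

(** For [r] < 2 the polynomial [Q n.-1] does not vanish at 0, as the coefficient relations require.
    They give [U], then [S] by division by m - 1, and finally the two series as (S + U)/2 and (S -
    U)/2. *)
Lemma yv_root_series_rat_poly (r m M : nat) : (r < 2)%N -> (1 < m < M)%N ->
  let D := fun n => (n %% 3)%N == r in
  rat_poly_on D (fun n => (root_series M (Q n))`_m) /\
  rat_poly_on D (fun n => (root_series M (Q n.-1))`_m).
Proof.
move=> r2 /andP [m1 mM] D.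
pose G n := root_series M (Q n); pose F n := root_series M (Q n.-1).
pose U n := G n - F n; pose S n := G n + F n.
have rf n : D n -> root (Q n.-1) 0 = false.
  by rewrite /D (yv_root0 Q0 Q1 yv_toda) => Dn; lia.
have rel n k : D n -> (k < M)%N ->
  (k%:R - 1) * (S n)`_k = - (U n ^+ 2)`_k /\
  (k%:R - 1) * (k%:R - 2) * (U n)`_k =
     (U n ^+ 3)`_k *+ 2 + ('X^3 * U n)`_k - n%:R * (k == 3)%:R.
  move=> Dn kM; apply: (@backlund_pair_coef _ M n (Q n.-1) (Q n)) => //.
  - by apply/negP => r0; have := rf n Dn; rewrite /root r0.
  - exact: Qsimple.
  - by apply: log_derivative_root_series => // x; apply: Qsimple.
  - by apply: log_derivative_root_series => // x; apply: Qsimple.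
  - exact: yv_backlund Q0 yv_toda n.
have hU : forall k, (k < M)%N -> rat_poly_on D (fun n => (U n)`_k).
  (* The constant term of [U] is 1 exactly when 0 is a root of [Q n], that is, when r = 1. *)
  apply: (@recursion_rat_poly _ D (r == 1%N)) => [n Dn|n k Dn kM k3|n k Dn kM].
  - rewrite coefB !coef0_root_series rf // subr0 (yv_root0 Q0 Q1 yv_toda).
    by rewrite (eqP Dn).
  - have k0 : (0 < k <= M)%N by case: k k3 kM => // k _ /ltnW.
    by rewrite coefB !coef_root_series // !yv_root_power_sum_eq0 // subrr.
  - by have [] := rel n k Dn kM.
have hS : rat_poly_on D (fun n => (S n)`_m).
  have c0 : (m%:R - 1 : rat) != 0 by rewrite subr_eq0 (eqr_nat _ _ 1); lia.
  apply: (rat_poly_on_cancel c0).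
  have hU2 : rat_poly_on D (fun n => (U n * U n)`_m).
    by apply: rat_poly_on_coefM => j jm; apply: hU; lia.
  apply: rat_poly_on_ext
    (rat_poly_onM (rat_poly_on_const _ D (-1)) hU2) => n Dn.
  by rewrite rmorphB rmorphN /= ratr_nat rmorph1 mulN1r (rel n m Dn mM).1 expr2.
have two : (2 : rat) != 0 by [].
have SE n : (S n)`_m = (G n)`_m + (F n)`_m by rewrite coefD.
have UE n : (U n)`_m = (G n)`_m - (F n)`_m by rewrite coefB.
split; apply: (rat_poly_on_cancel two).
  apply: rat_poly_on_ext (rat_poly_onD hS (hU m mM)) => n _.
  by rewrite ratr_nat SE UE -/(G n); ring.
apply: rat_poly_on_ext (rat_poly_onD hS
  (rat_poly_onM (rat_poly_on_const _ D (-1)) (hU m mM))) => n _.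
by rewrite rmorphN rmorph1 ratr_nat SE UE -/(F n); ring.
Qed.

Lemma yv_root_power_sum_rat_poly (m r : nat) : (3 <= m)%N -> (r < 3)%N ->
  rat_poly_on (fun n => (n %% 3)%N == r) (fun n => root_power_sum (Q n) m).
Proof.
move=> m3 r3; have m0 : (0 < m <= m.+1)%N by lia.
have m1 : (1 < m < m.+1)%N by lia.
have [r2|r2] := ltnP r 2.
  have [h _] := yv_root_series_rat_poly r2 m1.
  apply: rat_poly_on_ext (rat_poly_onM (rat_poly_on_const _ _ (-1)) h) => n _.
  by rewrite coef_root_series // rmorphN rmorph1 mulN1r opprK.
(* Now n = 2 mod 3, so [Q n] is the predecessor of [Q n.+1] with n + 1 = 0 mod 3; the resulting
   polynomial is shifted by 1. *)
have [_ [P hP]] := yv_root_series_rat_poly (isT : (0 < 2)%N) m1.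
exists (- (P \Po ('X + 1%:P))) => n /eqP nr.
have := hP n.+1; rewrite coef_root_series // hornerN horner_comp rmorphN /= !hornerE natr1.
by move=> <-; [rewrite opprK | lia].
Qed.
End YablonskiiVorobev.

Theorem mainTheorem6 (R : realType) (Q : nat -> {poly R[i]})
    (hQ : yablonskii_vorobev Q) :
  [/\ (forall m r : nat, (3 <= m)%N -> (3 %| m)%N -> (r < 3)%N ->
         exists P : {poly rat}, forall n : nat, n = r %[mod 3] ->
           root_power_sum (Q n) m = ratr P.[n%:R]),
      (forall m : nat, ~~ (3 %| m)%N ->
         forall n : nat, root_power_sum (Q n) m = 0) &
      (forall n m : nat, exists q : rat, root_power_sum (Q n) m = ratr q)].
Proof.
split=> [m r m3 _ r3|m m3 n|n m].
- have [P hP] := yv_root_power_sum_rat_poly hQ m3 r3.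
  by exists P => n nr; apply: hP; rewrite nr modn_small.
- exact: yv_root_power_sum_eq0.
have [d3|m3] := boolP (3 %| m)%N; last first.
  by exists 0; rewrite rmorph0 yv_root_power_sum_eq0.
have [Q0 _ _] := hQ.
have [->|m0] := eqVneq m 0.
  have [k ->] := root_power_sum0_nat (yv_neq0 Q0 (yv_toda hQ) n)
    (@yv_simple _ Q Q0 (yv_toda hQ) n).
  by exists k%:R; rewrite ratr_nat.
have m3 : (3 <= m)%N by apply: dvdn_leq; rewrite ?lt0n.
have [P hP] := yv_root_power_sum_rat_poly hQ m3 (ltn_pmod n (isT : (0 < 3)%N)).
by exists P.[n%:R]; apply: hP.
Qed.
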